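(* Let $\ell$ be an odd prime number and $t\in\mathbb{Z}_{\ge2}$. Then $$\mathrm{Prob}_\ell(X_t;\mu=0,\lambda=1)=\begin{cases}1-\dfrac{\ell^{t-1}+(-1)^{\frac{t(\ell-1)}{4}}(\ell-1)\ell^{\frac t2-1}-1}{\ell^t-1}&\text{if }t\text{ is even},\\[2mm]1-\dfrac{\ell^{t-1}-1}{\ell^t-1}&\text{if }t\text{ is odd}.\end{cases}$$
   Context: For $b\in\mathbb{Z}_\ell$ put $\binom{b}{n}=\frac{b(b-1)\cdots(b-n+1)}{n!}\in\mathbb{Z}_\ell$ and $(1+T)^b=\sum_{n\ge0}\binom{b}{n}T^n\in\mathbb{Z}_\ell[[T]]$. The bouquet $X_t$ is the multigraph with one vertex and $t$ undirected loops; a vector $\alpha=(\alpha_1,\dots,\alpha_t)\in\mathbb{Z}_\ell^t$ assigns the voltage $\alpha_j$ to the $j$-th loop. It is admissible if $\alpha\in\mathbb{Z}_\ell^t\setminus(\ell\mathbb{Z}_\ell)^t$. The characteristic series is $$f(T)=f_{X_t,\alpha}(T)=\sum_{j=1}^t\big(2-(1+T)^{\alpha_j}-(1+T)^{-\alpha_j}\big)\in\mathbb{Z}_\ell[[T]].$$ For admissible $\alpha$ it is nonzero, and it has zero constant term. By Weierstrass preparation write $f(T)=\ell^{\mu}g(T)u(T)$ with $\mu\in\mathbb{Z}_{\ge0}$, $g$ a distinguished polynomial (monic, all non-leading coefficients divisible by $\ell$) and $u\in\mathbb{Z}_\ell[[T]]^\times$. Then $\mu_\ell(X_t,\alpha):=\mu$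 and $\lambda_\ell(X_t,\alpha):=\deg g-1$ (note the shift by $-1$). Let $\tau$ be the Haar measure on $\mathbb{Z}_\ell^t$ normalized by $\tau(\mathbb{Z}_\ell^t)=1$, so $\tau(\mathbb{Z}_\ell^t\setminus(\ell\mathbb{Z}_\ell)^t)=1-\ell^{-t}$. Define $$\mathrm{Prob}_\ell(X_t;\mu=\mu_0,\lambda=\lambda_0)=(1-\ell^{-t})^{-1}\,\tau\big(\{\alpha\in\mathbb{Z}_\ell^t\setminus(\ell\mathbb{Z}_\ell)^t:\mu_\ell(X_t,\alpha)=\mu_0,\ \lambda_\ell(X_t,\alpha)=\lambda_0\}\big).$$ *)

(* Defs.v *)
From HB Require Import structures.
From mathcomp Require Import all_boot all_order all_algebra.
From mathcomp Require Import all_classical all_reals all_analysis.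

Set Implicit Arguments.
Unset Strict Implicit.
Unset Printing Implicit Defensive.

Import Order.TTheory GRing.Theory Num.Theory.

Local Open Scope classical_set_scope.
Local Open Scope ring_scope.

(** * The ring of l-adic integers, as the inverse limit of the Z/l^(n+1) *)

(* [zl_res x n] is the residue of [x] modulo l^(n+1); exponents start at 1
   because ['Z_1] is not the trivial ring.  The construction makes sense for
   every [l], but it is the ring of l-adic integers only when [l] is prime. *)
Record Zl (l : nat) := MkZl {
  zl_res : forall n, 'Z_(l ^ n.+1);
  zl_compat : forall n, zl_res n = (zl_res n.+1 : nat)%:R }.

Section ZlRing.
Variable l : nat.
Implicit Types x y z : Zl l.

Lemma zl_eq x y : (forall n, zl_res x n = zl_res y n) -> x = y.
Proof.
case: x y => [x cx] [y cy] /= exy.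
have {}exy : x = y by apply: functional_extensionality_dep.
by subst y; congr MkZl; exact: Prop_irrelevance.
Qed.

Lemma zl_trunc_dvd n :
  ((Zp_trunc (l ^ n.+1)).+2 %| (Zp_trunc (l ^ n.+2)).+2)%N.
Proof.
have [l1|l1] := ltnP 1 l.
  by rewrite !Zp_cast ?(ltn_exp2l 0 _ l1)// dvdn_exp2l.
by case: l l1 => [|[|//]] _; rewrite ?exp0n ?exp1n.
Qed.

Lemma zl_natr_mod n k :
  (k %% (Zp_trunc (l ^ n.+2)).+2)%:R = k%:R :> 'Z_(l ^ n.+1).
Proof.
by apply: val_inj; rewrite /= !Zp_nat /= modn_dvdm //; exact: zl_trunc_dvd.
Qed.

Fact zl_zero_compat n :
  (0 : 'Z_(l ^ n.+1)) = ((0%R : 'Z_(l ^ n.+2)) : nat)%:R.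
Proof. by []. Qed.

Fact zl_one_compat n :
  (1 : 'Z_(l ^ n.+1)) = ((1%R : 'Z_(l ^ n.+2)) : nat)%:R.
Proof. by []. Qed.

Fact zl_add_compat x y n : zl_res x n + zl_res y n =
  ((zl_res x n.+1 + zl_res y n.+1)%R : nat)%:R.
Proof. by rewrite /= zl_natr_mod natrD -!zl_compat. Qed.

Fact zl_mul_compat x y n : zl_res x n * zl_res y n =
  ((zl_res x n.+1 * zl_res y n.+1)%R : nat)%:R.
Proof. by rewrite /= zl_natr_mod natrM -!zl_compat. Qed.

Fact zl_opp_compat x n : - zl_res x n =
  ((- zl_res x n.+1)%R : nat)%:R.
Proof.
apply/eqP; rewrite -subr_eq0 -opprD oppr_eq0 [X in X + _]zl_compat -natrD.
rewrite -zl_natr_mod /= modnDmr subnKC ?modnn //.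
by rewrite ltnW.
Qed.

Definition zl_zero : Zl l := MkZl zl_zero_compat.
Definition zl_one : Zl l := MkZl zl_one_compat.
Definition zl_add x y : Zl l := MkZl (zl_add_compat x y).
Definition zl_mul x y : Zl l := MkZl (zl_mul_compat x y).
Definition zl_opp x : Zl l := MkZl (zl_opp_compat x).

HB.instance Definition _ := gen_eqMixin (Zl l).
HB.instance Definition _ := gen_choiceMixin (Zl l).

Fact zl_addA : associative zl_add.
Proof. by move=> x y z; apply: zl_eq => n /=; exact: addrA. Qed.
Fact zl_addC : commutative zl_add.
Proof. by move=> x y; apply: zl_eq => n /=; exact: addrC. Qed.
Fact zl_add0 : left_id zl_zero zl_add.
Proof. by move=> x; apply: zl_eq => n /=; exact: add0r. Qed.
Fact zl_addN : left_inverse zl_zero zl_opp zl_add.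
Proof. by move=> x; apply: zl_eq => n /=; exact: addNr. Qed.

HB.instance Definition _ :=
  GRing.isZmodule.Build (Zl l) zl_addA zl_addC zl_add0 zl_addN.

Fact zl_mulA : associative zl_mul.
Proof. by move=> x y z; apply: zl_eq => n /=; exact: mulrA. Qed.
Fact zl_mulC : commutative zl_mul.
Proof. by move=> x y; apply: zl_eq => n /=; exact: mulrC. Qed.
Fact zl_mul1 : left_id zl_one zl_mul.
Proof. by move=> x; apply: zl_eq => n /=; exact: mul1r. Qed.
Fact zl_mulD : left_distributive zl_mul zl_add.
Proof. by move=> x y z; apply: zl_eq => n /=; exact: mulrDl. Qed.
Fact zl_one_neq0 : zl_one != 0.
Proof.
by apply/eqP => /(congr1 (fun x => zl_res x 0)) /= /eqP; rewrite oner_eq0.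
Qed.

HB.instance Definition _ := GRing.Zmodule_isComNzRing.Build (Zl l)
  zl_mulA zl_mulC zl_mul1 zl_mulD zl_one_neq0.

HB.instance Definition _ := isPointed.Build (Zl l) 0.

(** The l-adic topology: a basis of neighbourhoods of [x] is given by the
    classes of [x] modulo l^(n+1). *)
Definition zl_nbhs x : set_system (Zl l) :=
  filter_from [set: nat] (fun n => [set y | zl_res y n = zl_res x n]).

Lemma zl_res_le x y m n : (m <= n)%N ->
  zl_res x n = zl_res y n -> zl_res x m = zl_res y m.
Proof.
move=> /subnK <-; elim: (n - m)%N => // k IH; rewrite addSn => exy.
by apply: IH; rewrite [LHS]zl_compat [RHS]zl_compat exy.
Qed.

Fact zl_nbhs_filter x : ProperFilter (zl_nbhs x).
Proof.
apply: filter_from_proper; last by move=> n _; exists x.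
apply: filter_from_filter; first by exists 0%N.
move=> m n _ _; exists (maxn m n) => // y /= exy; split => /=.
- exact: zl_res_le (leq_maxl _ _) exy.
- exact: zl_res_le (leq_maxr _ _) exy.
Qed.

Fact zl_nbhs_singleton x (A : set (Zl l)) : zl_nbhs x A -> A x.
Proof. by case=> n _; apply. Qed.

Fact zl_nbhs_nbhs x (A : set (Zl l)) : zl_nbhs x A -> zl_nbhs x (zl_nbhs^~ A).
Proof.
case=> n _ nA; exists n => // y /= eyx; exists n => // z /= ezy.
by apply: nA; rewrite /= ezy.
Qed.

HB.instance Definition _ := hasNbhs.Build (Zl l) zl_nbhs.
HB.instance Definition _ := Nbhs_isNbhsTopological.Build (Zl l)
  zl_nbhs_filter zl_nbhs_singleton zl_nbhs_nbhs.

End ZlRing.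

(** * Formal power series *)

Record fps (R : Type) := Fps { fps_coef : nat -> R }.

Section FpsRing.
Variable R : comNzRingType.
Implicit Types f g h : fps R.

Lemma fps_eq f g : (forall n, fps_coef f n = fps_coef g n) -> f = g.
Proof. by case: f g => [f] [g] /= /funext ->. Qed.

Definition fps_zero : fps R := Fps (fun _ => 0).
Definition fps_one : fps R := Fps (fun n => (n == 0%N)%:R).
Definition fps_add f g : fps R := Fps (fun n => fps_coef f n + fps_coef g n).
Definition fps_opp f : fps R := Fps (fun n => - fps_coef f n).
Definition fps_mul f g : fps R :=
  Fps (fun n => \sum_(i < n.+1) fps_coef f i * fps_coef g (n - i)%N).

HB.instance Definition _ := gen_eqMixin (fps R).
HB.instance Definition _ := gen_choiceMixin (fps R).

Fact fps_addA : associative fps_add.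
Proof. by move=> f g h; apply: fps_eq => n /=; exact: addrA. Qed.
Fact fps_addC : commutative fps_add.
Proof. by move=> f g; apply: fps_eq => n /=; exact: addrC. Qed.
Fact fps_add0 : left_id fps_zero fps_add.
Proof. by move=> f; apply: fps_eq => n /=; exact: add0r. Qed.
Fact fps_addN : left_inverse fps_zero fps_opp fps_add.
Proof. by move=> f; apply: fps_eq => n /=; exact: addNr. Qed.

HB.instance Definition _ :=
  GRing.isZmodule.Build (fps R) fps_addA fps_addC fps_add0 fps_addN.

Definition fps_trunc N f : {poly R} := \poly_(i < N) fps_coef f i.

Lemma fps_mul_trunc N f g n : (n < N)%N ->
  fps_coef (fps_mul f g) n = (fps_trunc N f * fps_trunc N g)`_n.
Proof.
move=> nN; rewrite coefM; apply: eq_bigr => i _; rewrite !coef_poly.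
by rewrite (leq_ltn_trans (leq_ord i) nN) (leq_ltn_trans (leq_subr _ _) nN).
Qed.

Fact fps_mulC : commutative fps_mul.
Proof.
by move=> f g; apply: fps_eq => n; rewrite !(fps_mul_trunc _ _ (ltnSn n)) mulrC.
Qed.

Fact fps_mulA : associative fps_mul.
Proof.
move=> f g h; apply: fps_eq => n.
pose T := fps_trunc n.+1.
transitivity ((T f * (T g * T h))`_n).
  rewrite coefM; apply: eq_bigr => i _; rewrite coef_poly ltn_ord.
  by rewrite (@fps_mul_trunc n.+1) // ltnS leq_subr.
rewrite mulrA coefM; apply: eq_bigr => i _; rewrite coef_poly ltnS leq_subr.
by rewrite (@fps_mul_trunc n.+1).
Qed.

Fact fps_mul1 : left_id fps_one fps_mul.
Proof.
move=> f; apply: fps_eq => n /=; rewrite big_ord_recl /= mul1r subn0.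
by rewrite big1 ?addr0 // => i _; rewrite mul0r.
Qed.

Fact fps_mulD : left_distributive fps_mul fps_add.
Proof.
move=> f g h; apply: fps_eq => n /=; rewrite -big_split /=.
by apply: eq_bigr => i _; rewrite mulrDl.
Qed.

Fact fps_one_neq0 : fps_one != 0.
Proof.
by apply/eqP => /(congr1 (fun f => fps_coef f 0)) /= /eqP; rewrite oner_eq0.
Qed.

HB.instance Definition _ := GRing.Zmodule_isComNzRing.Build (fps R)
  fps_mulA fps_mulC fps_mul1 fps_mulD fps_one_neq0.

Definition fps_unit f : Prop := exists g, f * g = 1.

Definition fps_of_poly (p : {poly R}) : fps R := Fps (fun n => p`_n).

End FpsRing.

(** * Characteristic series of the bouquet and Iwasawa invariants *)

Section Iwasawa.
Variable l : nat.

(* The quotient b(b-1)...(b-n+1) / n!, i.e. the element [c] such that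
   n! c = b(b-1)...(b-n+1); it exists and is unique when [l] is prime. *)
Definition zl_binom (b : Zl l) (n : nat) : Zl l :=
  xget 0 [set c | n`!%:R * c = \prod_(i < n) (b - i%:R)].

Definition onepT_pow (b : Zl l) : fps (Zl l) := Fps (zl_binom b).

Definition zl_dvd (x : Zl l) : Prop := exists y, x = l%:R * y.

Definition admissible (t : nat) (alpha : 'rV[Zl l]_t) : Prop :=
  ~ forall j, zl_dvd (alpha 0 j).

Definition char_series (t : nat) (alpha : 'rV[Zl l]_t) : fps (Zl l) :=
  \sum_(j < t) (2 - onepT_pow (alpha 0 j) - onepT_pow (- alpha 0 j)).

Definition distinguished (g : {poly Zl l}) : Prop :=
  g \is monic /\ forall i, (i < (size g).-1)%N -> zl_dvd g`_i.

Definition is_weierstrass (f : fps (Zl l))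
    (w : nat * {poly Zl l} * fps (Zl l)) : Prop :=
  [/\ f = l%:R ^+ w.1.1 * fps_of_poly w.1.2 * w.2,
      distinguished w.1.2 & fps_unit w.2].

(* The Weierstrass factorization of [f], which is unique when [l] is prime and
   [f] is nonzero. *)
Definition weierstrass (f : fps (Zl l)) : nat * {poly Zl l} * fps (Zl l) :=
  xget (0%N, 0, 0) (is_weierstrass f).

Definition mu_inv (t : nat) (alpha : 'rV[Zl l]_t) : nat :=
  (weierstrass (char_series alpha)).1.1.

Definition lambda_inv (t : nat) (alpha : 'rV[Zl l]_t) : int :=
  ((size (weierstrass (char_series alpha)).1.2).-1)%:Z - 1.

End Iwasawa.

(** * Haar measure on Z_l^t *)

Definition borelZl (l t : nat) : Type :=
  g_sigma_algebraType (@open 'rV[Zl l]_t).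
HB.instance Definition _ (l t : nat) := Measurable.on (borelZl l t).

(* The normalization tau(Z_l^t) = 1 is part of [probability]. *)
Definition haar (R : realType) (l t : nat)
    (tau : probability (borelZl l t) R) : Prop :=
  forall (a : 'rV[Zl l]_t) (A : set (borelZl l t)), measurable A ->
    tau [set a + x | x in (A : set 'rV[Zl l]_t)] = tau A.

Definition Prob (R : realType) (l t : nat) (tau : probability (borelZl l t) R)
    (mu0 : nat) (lambda0 : int) : \bar R :=
  (((1 - (l%:R ^+ t)^-1)^-1)%:E *
   tau [set alpha : 'rV[Zl l]_t |
     [/\ admissible alpha, mu_inv alpha = mu0 & lambda_inv alpha = lambda0]])%E.

(* Main.v *)
(* Write q(a) for the sum of the a_j^2.  Since (1+T)^a + (1+T)^(-a) =
   2 + a^2 T^2 + O(T^3), we have f = - q(alpha) T^2 + O(T^3).  Hence mu = 0 and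
   deg g = 2 if and only if q(alpha) is nonzero modulo l: in that case
   f = T^2 u with u a unit, and in general, when mu = 0, deg g is the order of
   vanishing of f modulo l.  All classes modulo l have Haar measure l^(-t), so
   the probability is (l^t - N) / (l^t - 1) with N the number of zeros of q in
   F_l^t.  Counting x^2 + y^2 = b with the quadratic character chi gives
   N_(t+2)(a) = (l - chi(-1)) l^t + chi(-1) l N_t(a) for the number N_t(a) of
   solutions of q(x) = a in F_l^t. *)
Require Import Defs.
From mathcomp Require Import all_boot all_order all_algebra.
From mathcomp Require Import all_solvable all_field.
From mathcomp Require Import all_classical all_reals all_analysis.
From mathcomp Require Import ring.

Set Implicit Arguments.
Unset Strict Implicit.
Unset Printing Implicit Defensive.

Import Order.TTheory GRing.Theory Num.Theory.

Local Open Scope ring_scope.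

(** * Zeros of a sum of squares over a finite field *)

Lemma sum_indicator (T : finType) (A : pzSemiRingType) (P : pred T) :
  \sum_x (P x)%:R = #|[set x | P x]|%:R :> A.
Proof.
rewrite cardsE -sum1_card natr_sum [RHS]big_mkcond /=.
by apply: eq_bigr => x _; rewrite -topredE /=; case: (P x).
Qed.

Section QuadraticCharacter.
Variables (F : finFieldType) (F_odd : odd #|F|).
Implicit Types a b u x y : F.

Let m := #|F|.-1./2.

Lemma card_field_half : #|F| = m.*2.+1.
Proof.
have F_gt1 := finNzRing_gt1 F.
rewrite /m halfK -subn1 oddB ?F_odd ?(ltnW F_gt1) //= subn0 subn1.
by rewrite prednK // ltnW.
Qed.

Lemma expf_cardB1 a : a != 0 -> a ^+ m.*2 = 1.
Proof.
move=> a0; apply: (mulfI a0).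
by rewrite -exprS -card_field_half expf_card mulr1.
Qed.

Lemma expf_half a : a != 0 -> (a ^+ m == 1) || (a ^+ m == -1).
Proof. by move=> a0; rewrite -eqf_sqr expr1n -exprM muln2 expf_cardB1. Qed.

Lemma half_card_gt0 : (0 < m)%N.
Proof. by have := finNzRing_gt1 F; rewrite card_field_half ltnS double_gt0. Qed.

(** The nonzero elements are [m.*2] distinct roots of [X^(2m) - 1], which forces one of them to be
    primitive. *)
Lemma finField_prim_root : exists z : F, m.*2.-primitive_root z.
Proof.
have /hasP[z _ zP] : has m.*2.-primitive_root (enum (predC1 (0 : F))).
  apply: has_prim_root; rewrite ?double_gt0 ?half_card_gt0 ?enum_uniq //.
    apply/allP => x; rewrite mem_enum inE => x0.
    by apply/unity_rootP; exact: expf_cardB1.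
  by rewrite -cardE cardC1 card_field_half.
by exists z.
Qed.

(** If [-1 = 1], a primitive root [z] would satisfy [z ^+ m = 1], contradicting its order
    [m.*2 > m]. *)
Lemma neqN1 : (-1 : F) != 1.
Proof.
have [z zP] := finField_prim_root.
have z0 : z != 0.
  apply: contra_eq_neq (prim_expr_order zP) => ->.
  by rewrite expr0n double_eq0 -leqn0 leqNgt half_card_gt0 eq_sym oner_eq0.
apply/eqP => N11; have := expf_half z0.
rewrite N11 orbb -(prim_order_dvd zP) => /(dvdn_leq half_card_gt0).
by rewrite -addnn -{3}[m]addn0 leq_add2l leqNgt half_card_gt0.
Qed.

(** Euler's criterion. For the construction of a root, write [a] as a power [z ^+ i] of a primitive
    root: [a ^+ m = 1] makes [i] even. *)
Lemma is_square_half a : a != 0 -> (a ^+ m == 1) = [exists y, y ^+ 2 == a].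
Proof.
move=> a0; apply/eqP/existsP => [am|[y /eqP ya]]; last first.
  rewrite -ya -exprM mul2n expf_cardB1 //.
  by apply: contraNneq a0 => y0; rewrite -ya y0 expr0n.
have [z zP] := finField_prim_root.
have [[i /= _] ai] := prim_rootP zP (expf_cardB1 a0).
exists (z ^+ i./2); rewrite -exprM muln2.
move: am; rewrite ai -exprM => /eqP; rewrite -(prim_order_dvd zP).
rewrite -muln2 mulnC dvdn_pmul2r ?half_card_gt0 // dvdn2 => i_even.
by rewrite (even_halfK) // negbK.
Qed.

(** * The quadratic character and its sums *)

Variable A : comNzRingType.

(** The Legendre symbol, read off from Euler's criterion. Its values lie in [A], so that signed
    counts can be formed directly in the reals. *)
Definition quad_char a : A := if a == 0 then 0 else (-1) ^+ (a ^+ m != 1).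
Local Notation chi := quad_char.

Lemma quad_char0 : chi 0 = 0.
Proof. by rewrite /chi eqxx. Qed.

Lemma quad_charM : {morph chi : a b / a * b}.
Proof.
move=> a b; rewrite /chi mulf_eq0.
have [a0|a0] := eqVneq a 0; first by rewrite mul0r.
have [b0|b0] := eqVneq b 0; first by rewrite mulr0.
rewrite -signr_addb exprMn; congr (_ ^+ nat_of_bool _).
have N11 := negPf neqN1.
case/orP: (expf_half a0) => /eqP->; case/orP: (expf_half b0) => /eqP->;
  by rewrite ?(mulr1, mul1r, mulrNN, eqxx, N11).
Qed.

Lemma quad_char_sqr a : a != 0 -> chi a ^+ 2 = 1.
Proof. by move=> a0; rewrite /chi (negPf a0) sqrr_sign. Qed.

Lemma quad_charN1 : chi (-1) = (-1) ^+ m.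
Proof.
rewrite /chi oppr_eq0 oner_eq0 -[in RHS]signr_odd -(signr_odd F m).
by case: (odd m); rewrite ?expr1 ?expr0 ?neqN1 ?eqxx.
Qed.

Lemma sum_sqr_eq a : \sum_(y : F) (y ^+ 2 == a)%:R = 1 + chi a :> A.
Proof.
rewrite sum_indicator /chi.
have [->|a0] := eqVneq a 0.
  rewrite addr0 (_ : [set x | _] = [set 0]) ?cards1 //.
  by apply/setP => x; rewrite !inE sqrf_eq0.
rewrite is_square_half //; case: existsP => [[y /eqP ya]|nex] /=; last first.
  rewrite addrN eq_card0 // => y; rewrite inE; apply/negP => ya.
  by apply: nex; exists y.
have y0 : y != 0 by apply: contraNneq a0 => y0; rewrite -ya y0 expr0n.
rewrite (_ : [set x | _] = [set y; - y]) ?cards2.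
  suff -> : y != - y by [].
  by rewrite -mulN1r -{1}[y]mul1r (inj_eq (mulIf y0)) eq_sym neqN1.
by apply/setP => x; rewrite !inE -ya eqf_sqr.
Qed.

(** Summing the number [1 + chi a] of square roots over all [a] counts each [y] once, so the total
    is [#|F|]. *)
Lemma sum_quad_char : \sum_a chi a = 0.
Proof.
have : \sum_(a : F) \sum_(y : F) (y ^+ 2 == a)%:R = #|F|%:R :> A.
  rewrite exchange_big /= -sum1_card natr_sum; apply: eq_bigr => y _.
  rewrite (bigD1 (y ^+ 2)) //= eqxx big1 ?addr0 // => a.
  by rewrite eq_sym => /negPf->.
under eq_bigr do rewrite sum_sqr_eq.
by rewrite big_split /= sumr_const -[RHS]addr0 => /addrI.
Qed.

(** A Jacobi sum. For [b = 0] each nonzero [u] contributes [chi (-1)]. For [b != 0] the summand is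
    [chi (b / u - 1)], and [b / u - 1] takes every value except [-1]. *)
Lemma sum_quad_char_conv b :
  \sum_u chi u * chi (b - u) = chi (-1) * ((b == 0)%:R * #|F|%:R - 1).
Proof.
rewrite (bigD1 0) //= quad_char0 mul0r add0r.
have [->|b0] := eqVneq b 0.
  rewrite mul1r (eq_bigr (fun _ => chi (-1))) => [|u u0].
    rewrite sumr_const (@cardD1 _ 0 (mem F)) add1n -addn1 natrD addrK mulr_natr.
    by congr (_ *+ _); apply: eq_card => u; rewrite !inE andbT.
  by rewrite sub0r -[- u]mulN1r !quad_charM mulrCA -expr2 quad_char_sqr ?mulr1.
rewrite mul0r sub0r.
transitivity (\sum_(u | u != 0) chi (b / u - 1)).
  apply: eq_bigr => u u0.
  have -> : b - u = u * (b / u - 1) by field.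
  by rewrite quad_charM mulrA -expr2 quad_char_sqr ?mul1r.
rewrite (reindex_onto (fun w => b / (w + 1)) (fun u => b / u - 1)) /=;
  last first.
  by move=> u u0; rewrite subrK invf_div mulrCA divff ?mulr1.
rewrite (eq_bigr chi) => [|w]; last first.
  case/andP => w0 _; congr chi; rewrite invf_div mulrA mulrAC divff // mul1r.
  by rewrite addrK.
have := sum_quad_char; rewrite (bigD1 (-1)) //= mulrN1 addrC => /eqP.
rewrite addr_eq0 => /eqP <-; apply: eq_bigl => w.
have [->|w1] := eqVneq w (-1); first by rewrite addNr invr0 mulr0 eqxx.
have w1' : w + 1 != 0 by rewrite -[1]opprK subr_eq0.
by rewrite mulf_neq0 ?invr_neq0 //= invf_div mulrCA divff // mulr1 addrK eqxx.
Qed.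

(** Sorting by [u = x ^+ 2] gives the sum of [(1 + chi u) * (1 + chi (b - u))]; the two linear terms
    vanish and the product term is the Jacobi sum. *)
Lemma sum_two_sqr_eq b : \sum_(x : F) \sum_(y : F) (x ^+ 2 + y ^+ 2 == b)%:R =
  #|F|%:R + chi (-1) * ((b == 0)%:R * #|F|%:R - 1) :> A.
Proof.
transitivity (\sum_(x : F) \sum_(u : F) (x ^+ 2 == u)%:R * (1 + chi (b - u))).
  apply: eq_bigr => x _; rewrite [RHS](bigD1 (x ^+ 2)) //= eqxx mul1r.
  rewrite [X in _ + X]big1 ?addr0 => [|u]; last first.
    by rewrite eq_sym => /negPf->; rewrite mul0r.
  rewrite -sum_sqr_eq; apply: eq_bigr => y _.
  by rewrite [in RHS]eq_sym subr_eq eq_sym addrC.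
rewrite exchange_big /=.
under eq_bigr do rewrite -mulr_suml sum_sqr_eq mulrDl mul1r mulrDr mulr1.
rewrite !big_split /= sum_quad_char add0r sum_quad_char_conv.
rewrite sumr_const (reindex_inj (can_inj (subKr b))) /=.
under [X in _ + X + _]eq_bigr do rewrite subKr.
by rewrite sum_quad_char addr0.
Qed.

(** * Counting solutions of a sum of squares equal to a constant *)

Definition sphere_count t a : A :=
  \sum_(x : 'rV[F]_t) (\sum_j x 0 j ^+ 2 == a)%:R.

Lemma sum_rowS t (h : 'rV[F]_t.+1 -> A) :
  \sum_x h x = \sum_(y : F) \sum_(x : 'rV_t) h (row_mx y%:M x : 'rV_(1 + t)).
Proof.
pose h' (p : F * 'rV_t) : 'rV_(1 + t) := row_mx p.1%:M p.2.
rewrite pair_big /= (reindex h') //=.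
exists (fun x : 'rV_(1 + t) => (lsubmx x 0 0, rsubmx x)) => [[y x] _|x _] /=.
  by rewrite row_mxKl row_mxKr mxE eqxx mulr1n.
rewrite -[RHS]hsubmxK; congr row_mx.
by apply/rowP => j; rewrite ord1 !mxE eqxx.
Qed.

Lemma sphere_count0 a : sphere_count 0 a = (a == 0)%:R.
Proof.
rewrite /sphere_count (bigD1 0) //= big_ord0 eq_sym big1 ?addr0 // => x /eqP[].
by apply/rowP => -[].
Qed.

Lemma sphere_countS t a :
  sphere_count t.+1 a = \sum_y sphere_count t (a - y ^+ 2).
Proof.
rewrite /sphere_count sum_rowS; apply: eq_bigr => y _; apply: eq_bigr => x _.
have -> : \sum_(j < t.+1) (row_mx y%:M x : 'rV_(1 + t)) 0 j ^+ 2 =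
    y ^+ 2 + \sum_j x 0 j ^+ 2.
  rewrite (@big_split_ord _ _ _ 1 t) big_ord1 row_mxEl mxE eqxx mulr1n.
  by congr (_ + _); apply: eq_bigr => j _; rewrite row_mxEr.
by rewrite [in RHS]eq_sym subr_eq eq_sym addrC.
Qed.

Lemma sum_sphere_count t : \sum_b sphere_count t b = #|F|%:R ^+ t.
Proof.
rewrite exchange_big /= -natrX -[t in RHS]mul1n -card_mx -sum1_card natr_sum.
apply: eq_bigr => x _; rewrite (bigD1 (\sum_j x 0 j ^+ 2)) //= eqxx.
by rewrite big1 ?addr0 // => b; rewrite eq_sym => /negPf->.
Qed.

(** Two coordinates are grouped by their sum of squares [b]. The number of such pairs is the
    constant [#|F| - chi (-1)], plus an excess [chi (-1) * #|F|] at [b = 0] only. *)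
Lemma sphere_countSS t a : sphere_count t.+2 a =
  (#|F|%:R - chi (-1)) * #|F|%:R ^+ t + chi (-1) * #|F|%:R * sphere_count t a.
Proof.
transitivity (\sum_b (\sum_(x : F) \sum_(y : F) (x ^+ 2 + y ^+ 2 == b)%:R) *
                     sphere_count t (a - b)).
  under [RHS]eq_bigr do rewrite mulr_suml.
  rewrite exchange_big sphere_countS /=; apply: eq_bigr => x _.
  under [RHS]eq_bigr do rewrite mulr_suml.
  rewrite exchange_big sphere_countS /=; apply: eq_bigr => y _.
  rewrite (bigD1 (x ^+ 2 + y ^+ 2)) //= eqxx mul1r opprD addrA.
  by rewrite big1 ?addr0 // => b; rewrite eq_sym => /negPf->; rewrite mul0r.
under eq_bigr do rewrite sum_two_sqr_eq.
rewrite -sum_sphere_count (bigD1 0) //= eqxx subr0 mul1r.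
rewrite (eq_bigr (fun b => (#|F|%:R - chi (-1)) * sphere_count t (a - b))) =>
  [|b /negPf->]; last first.
  by rewrite mul0r sub0r mulrN1.
rewrite -mulr_sumr [\sum_b _ in RHS](reindex_inj (can_inj (subKr a))) /=.
by rewrite [in RHS](bigD1 0) //= subr0; ring.
Qed.

(** Starting from one variable, where only zero is a solution, the [chi (-1)] terms of the recursion
    cancel. *)
Lemma sphere_count_odd k : sphere_count k.*2.+1 0 = #|F|%:R ^+ k.*2.
Proof.
elim: k => [|k IH]; last by rewrite doubleS sphere_countSS IH !exprS; ring.
rewrite sphere_countS expr0 (bigD1 0) //= sphere_count0 sub0r expr0n oppr0 eqxx.
rewrite big1 ?addr0 // => y y0.
by rewrite sphere_count0 sub0r oppr_eq0 sqrf_eq0 (negPf y0).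
Qed.

Lemma sphere_count_even k : sphere_count k.+1.*2 0 =
  #|F|%:R ^+ k.*2.+1 + (-1) ^+ (m * k.+1) * (#|F|%:R - 1) * #|F|%:R ^+ k.
Proof.
(* The sign becomes [chi (-1) ^+ k.+1], which gains one factor at each use of the recursion. *)
rewrite exprM -quad_charN1; elim: k => [|k IH].
  by rewrite sphere_countSS sphere_count0 eqxx !expr1 !expr0 mulr1n; ring.
by rewrite doubleS sphere_countSS IH doubleS !exprS; ring.
Qed.

End QuadraticCharacter.

Local Open Scope classical_set_scope.

(** * Residues of power series and Iwasawa invariants *)

Section FpsFacts.
Variable R : comNzRingType.
Implicit Types f g : fps R.

Lemma fps_coef_sum (I : Type) (r : seq I) (P : pred I) (F : I -> fps R) n :
  fps_coef (\sum_(i <- r | P i) F i) n = \sum_(i <- r | P i) fps_coef (F i) n.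
Proof. exact: (big_morph (fun f => fps_coef f n)). Qed.

Lemma fps_coef_mulrn f k n : fps_coef (f *+ k) n = fps_coef f n *+ k.
Proof. by elim: k => // k IH; rewrite !mulrS -IH. Qed.

(* The first [n.+1] coefficients of the inverse, highest index first. *)
Fixpoint fps_inv_seq (a : nat -> R) (c : R) n : seq R :=
  if n is n'.+1 then
    let s := fps_inv_seq a c n' in
    - c * (\sum_(i < n) a i.+1 * s`_i) :: s
  else [:: c].

Lemma nth_fps_inv_seq a c n i : (i <= n)%N ->
  (fps_inv_seq a c n)`_i = (fps_inv_seq a c (n - i))`_0.
Proof. by elim: n i => [|n IH] [|i] //=; rewrite ltnS => /IH. Qed.

(** Given an inverse [c] of the constant term, the coefficients of the inverse series are solved for
    one after another. *)
Lemma fps_unitP f : fps_unit f <-> exists c, fps_coef f 0 * c = 1.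
Proof.
split=> [[g fg]|[c fc]].
  exists (fps_coef g 0); move: fg => /(congr1 (fun h => fps_coef h 0)) /=.
  by rewrite big_ord1 subn0.
pose s := fps_inv_seq (fps_coef f) c.
exists (Fps (fun n => (s n)`_0)); apply: fps_eq => -[|n] /=.
  by rewrite big_ord1.
rewrite big_ord_recl subn0 /= mulrA mulrN fc mulN1r.
apply/eqP; rewrite addrC subr_eq0; apply/eqP/eq_bigr => i _.
(* Entry [i] of the list built at stage [n] is the coefficient of index [n - i], as the Cauchy
   product requires. *)
by rewrite subSS [X in _ = _ * X]nth_fps_inv_seq // leq_ord.
Qed.

End FpsFacts.

(** * Reduction modulo l and units of the l-adic integers *)

Section Reduction.
Variables (l : nat) (l_prime : prime l).
Implicit Types x y : Zl l.

Let l_gt1 : (1 < l)%N := prime_gt1 l_prime.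

(** Level 0 is already the residue modulo [l], but in ['Z_(l ^ 1)]; the cast through [nat] moves it
    to the field ['F_l]. *)
Definition zl_red x : 'F_l := (zl_res x 0 : nat)%:R.

Lemma natr_Zp_mod n k :
  (k %% (Zp_trunc (l ^ n.+1)).+2)%:R = k%:R :> 'F_l.
Proof.
rewrite (@Zp_cast (l ^ n.+1)) ?(ltn_exp2l 0 _ l_gt1) // -(Fp_nat_mod l_prime).
by rewrite modn_dvdm ?dvdn_exp // Fp_nat_mod.
Qed.

Lemma zl_red_res x n : (zl_res x n : nat)%:R = zl_red x.
Proof.
elim: n => // n <-.
rewrite [in RHS](zl_compat x n) (@Zp_nat (Zp_trunc (l ^ n.+1))).
exact/esym/natr_Zp_mod.
Qed.

Lemma zl_redD : {morph zl_red : x y / x + y}.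
Proof. by move=> x y; rewrite /zl_red /= natr_Zp_mod natrD. Qed.

Lemma zl_redM : {morph zl_red : x y / x * y}.
Proof. by move=> x y; rewrite /zl_red /= natr_Zp_mod natrM. Qed.

Lemma zl_red1 : zl_red 1 = 1. Proof. by []. Qed.

Lemma zl_red0 : zl_red 0 = 0. Proof. by []. Qed.

Lemma zl_redN : {morph zl_red : x / - x}.
Proof.
by move=> x; apply/eqP; rewrite -addr_eq0 -zl_redD addNr.
Qed.

Lemma zl_red_sum (I : Type) (r : seq I) (P : pred I) (F : I -> Zl l) :
  zl_red (\sum_(i <- r | P i) F i) = \sum_(i <- r | P i) zl_red (F i).
Proof. exact: (big_morph zl_red zl_redD). Qed.

Lemma zl_red_natr k : zl_red k%:R = k%:R.
Proof. by elim: k => // k IH; rewrite !mulrS zl_redD IH. Qed.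

Lemma zl_red_eq x y : zl_red x = zl_red y <-> zl_res x 0 = zl_res y 0.
Proof.
split=> [|exy]; last by rewrite /zl_red exy.
move=> /(congr1 (@nat_of_ord _)); rewrite /zl_red !val_Fp_nat //.
have res_lt (z : Zl l) : (zl_res z 0 < l)%N.
  by rewrite (leq_trans (ltn_ord _)) // Zp_cast expn1.
by rewrite !modn_small // => /val_inj.
Qed.

Lemma zl_dvd_red x : zl_dvd x -> zl_red x = 0.
Proof.
case=> y ->.
by rewrite zl_redM zl_red_natr mulr_natl mulrn_pchar ?pchar_Fp.
Qed.

(** An element prime to [l] is invertible at every level [l ^ n.+1]; the levelwise inverses are
    compatible because inverses are unique. *)
Lemma zl_unitP x : (exists y, x * y = 1) <-> zl_red x != 0.
Proof.
split=> [[y xy]|x0].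
  apply/eqP => x0; move: xy => /(congr1 zl_red).
  by rewrite zl_redM x0 mul0r zl_red1 => /esym/eqP; rewrite oner_eq0.
have xn_unit n : zl_res x n \is a GRing.unit.
  rewrite -[zl_res x n]natr_Zp unitZpE ?(ltn_exp2l 0 _ l_gt1) //.
  rewrite coprime_pexpl // prime_coprime // (dvdn_pcharf (pchar_Fp l_prime)).
  by rewrite zl_red_res.
have compat n : (zl_res x n)^-1 = (((zl_res x n.+1)^-1)%R : nat)%:R.
  apply: (mulrI (xn_unit n)); rewrite divrr; last exact: xn_unit.
  rewrite [zl_res x n]zl_compat; apply: etrans (natrM _ _ _).
  rewrite -zl_natr_mod.
  rewrite -[(_ %% _)%N]/(nat_of_ord (zl_res x n.+1 / zl_res x n.+1)).
  by rewrite divrr ?xn_unit.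
by exists (MkZl compat); apply: zl_eq => n /=; rewrite divrr ?xn_unit.
Qed.

Lemma zl_lreg x y z : zl_red x != 0 -> x * y = x * z -> y = z.
Proof.
move=> /zl_unitP[c xc] /(congr1 ( *%R c)).
by rewrite !mulrA [c * x]mulrC xc !mul1r.
Qed.

(** The factorial is a unit, so the quotient selected by [xget] exists and is unique. For odd [l]
    this covers [n <= 2]. *)
Lemma zl_binomE (b c : Zl l) n : zl_red (n`!%:R) != 0 ->
  n`!%:R * c = \prod_(i < n) (b - i%:R) -> zl_binom b n = c.
Proof.
move=> n0 nc; apply: xget_unique => // d /=.
by rewrite -nc; exact: zl_lreg.
Qed.

Lemma zl_binom0 (b : Zl l) : zl_binom b 0 = 1.
Proof. by apply: zl_binomE; rewrite ?zl_red1 ?oner_eq0 // big_ord0 mulr1. Qed.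

Lemma zl_binom1 (b : Zl l) : zl_binom b 1 = b.
Proof.
by apply: zl_binomE; rewrite ?zl_red1 ?oner_eq0 // big_ord1 mul1r subr0.
Qed.

Hypothesis l_odd : odd l.

Lemma zl_red2 : zl_red 2 != 0.
Proof.
rewrite zl_red_natr -(dvdn_pcharf (pchar_Fp l_prime)) dvdn_prime2 //.
by apply: contraTneq l_odd => ->.
Qed.

Lemma zl_binom2 (b : Zl l) : 2 * zl_binom b 2 = b * (b - 1).
Proof.
have [h h2] := (zl_unitP 2).2 zl_red2.
rewrite (@zl_binomE b (h * (b * (b - 1))) 2) ?zl_red2 //.
  by rewrite mulrA h2 mul1r.
by rewrite !big_ord_recl big_ord0 /= subr0 mulr1 mulrA h2 mul1r.
Qed.

(** * Low-order coefficients of the characteristic series and its Weierstrass factorization *)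

Lemma char_series_coef t (alpha : 'rV[Zl l]_t) n :
  fps_coef (char_series alpha) n = \sum_j
    ((n == 0%N)%:R *+ 2 - zl_binom (alpha 0 j) n - zl_binom (- alpha 0 j) n).
Proof.
rewrite fps_coef_sum; apply: eq_bigr => j _.
by rewrite -(fps_coef_mulrn 1 2 n).
Qed.

Lemma char_series_coef0 t (alpha : 'rV[Zl l]_t) :
  fps_coef (char_series alpha) 0 = 0.
Proof.
rewrite char_series_coef big1 // => j _.
by rewrite !zl_binom0 addrK subrr.
Qed.

Lemma char_series_coef1 t (alpha : 'rV[Zl l]_t) :
  fps_coef (char_series alpha) 1 = 0.
Proof.
rewrite char_series_coef big1 // => j _.
by rewrite !zl_binom1 mul0rn sub0r subrr.
Qed.

Lemma char_series_coef2 t (alpha : 'rV[Zl l]_t) :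
  fps_coef (char_series alpha) 2 = - \sum_j alpha 0 j ^+ 2.
Proof.
rewrite char_series_coef -sumrN; apply: eq_bigr => j _.
(* After doubling, the claim is [a * (a - 1) + a * (a + 1) = 2 * a ^+ 2]. *)
apply: (zl_lreg zl_red2).
by rewrite mul0rn sub0r mulrBr mulrN !zl_binom2; ring.
Qed.

(** Modulo [l] a distinguished polynomial is the monomial given by its leading term, so
    multiplication by it only shifts [u]. *)
Lemma distinguished_mul_coef (g : {poly Zl l}) (u : fps (Zl l)) i :
  distinguished g -> (i <= (size g).-1)%N ->
  zl_red (fps_coef (fps_of_poly g * u) i) =
  if i == (size g).-1 then zl_red (fps_coef u 0) else 0.
Proof.
move=> [g_monic g_dvd] ig /=; rewrite big_ord_recr /= zl_redD zl_red_sum big1.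
  rewrite add0r subnn zl_redM; case: eqP => [->|/eqP ni].
    by rewrite -lead_coefE (monicP g_monic) zl_red1 mul1r.
  by rewrite zl_dvd_red ?mul0r //; apply: g_dvd; rewrite ltn_neqAle ni.
move=> k _; rewrite zl_redM zl_dvd_red ?mul0r //.
by apply: g_dvd; exact: leq_trans (ltn_ord k) ig.
Qed.

Lemma fps_unit_red (u : fps (Zl l)) : fps_unit u <-> zl_red (fps_coef u 0) != 0.
Proof. by rewrite fps_unitP zl_unitP. Qed.

Lemma weierstrass_order2 (f : fps (Zl l)) (w := weierstrass f) :
  fps_coef f 0 = 0 -> fps_coef f 1 = 0 ->
  (w.1.1 = 0%N /\ ((size w.1.2).-1)%:Z - 1 = 1 :> int) <->
  zl_red (fps_coef f 2) != 0.
Proof.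
move=> f0 f1.
(* When mu is 0, the degree of the polynomial factor is the index of the first coefficient of [f]
   not divisible by [l]. *)
have wE : is_weierstrass f w -> w.1.1 = 0%N ->
    forall i, (i <= (size w.1.2).-1)%N ->
    (zl_red (fps_coef f i) != 0) = (i == (size w.1.2).-1).
  move=> [-> g_dist /fps_unit_red u0] -> i ig; rewrite expr0 mul1r.
  by rewrite distinguished_mul_coef //; case: (i == _); rewrite ?u0 ?eqxx.
split=> [[mu0 deg2]|f2].
  have {}deg2 : (size w.1.2).-1 = 2%N.
    by case: (canRL (subrK 1) deg2).
  have [fw|nfw] := pselect (exists w', is_weierstrass f w').
    by rewrite (wE (xgetPex _ fw)) // deg2.
  (* Without a factorization, [xget] returns its default, whose polynomial is 0 and cannot have
     degree 2. *)
  move: deg2; rewrite /w /weierstrass xgetPN ?size_poly0 //= => w' fw'.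
  by apply: nfw; exists w'.
have fw : is_weierstrass f w.
  (* As [f] has no terms of degree 0 and 1, [f] is [X^2] times its shift [u], whose constant term is
     the coefficient of degree 2. *)
  pose u := Fps (fun n => fps_coef f n.+2).
  apply: (@xgetPex _ (0%N, 0, 0) (is_weierstrass f)).
  exists (0%N, 'X^2, u); split => /=.
  - rewrite expr0 mul1r; apply: fps_eq => -[|[|n]] /=.
    + by rewrite big_ord1 coefXn mul0r.
    + by rewrite !big_ord_recl big_ord0 /= !coefXn !mul0r !addr0.
    rewrite !big_ord_recl /= !coefXn !mul0r !add0r mul1r subSS subSS subn0.
    by rewrite big1 ?addr0 // => i _; rewrite coefXn mul0r.
  - split=> [|i]; first exact: monicXn.
    rewrite size_polyXn /= => i2; exists 0.
    by rewrite coefXn (ltn_eqF i2) mulr0.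
  - exact/fps_unit_red.
(* A positive exponent of [l] would make every coefficient of [f], and the one of degree 2 in
   particular, divisible by [l]. *)
have mu0 : w.1.1 = 0%N.
  case: fw f2 => {wE}; case: (w.1.1) => // k -> _ _.
  rewrite exprS -mulrA -mulrA mulr_natl fps_coef_mulrn => /eqP[].
  by apply: zl_dvd_red; eexists; rewrite mulr_natl.
split=> //.
suff -> : (size w.1.2).-1 = 2%N by [].
have := wE fw mu0; case: (_.-1) => [|[|[|n]]] // {}wE.
- by have := wE 0%N isT; rewrite f0 zl_red0 eqxx.
- by have := wE 1%N isT; rewrite f1 zl_red0 eqxx.
- by have := wE 2%N isT; rewrite f2.
Qed.

Lemma invariants_red t (alpha : 'rV[Zl l]_t) :
  [/\ admissible alpha, mu_inv alpha = 0%N & lambda_inv alpha = 1] <->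
  \sum_j zl_red (alpha 0 j) ^+ 2 != 0.
Proof.
have f2 : zl_red (fps_coef (char_series alpha) 2) =
    - \sum_j zl_red (alpha 0 j) ^+ 2.
  rewrite char_series_coef2 zl_redN zl_red_sum; congr (- _).
  by apply: eq_bigr => j _; exact: zl_redM.
rewrite -[_ != 0]negbK -oppr_eq0 -f2 negbK.
have order2 :=
  weierstrass_order2 (char_series_coef0 alpha) (char_series_coef1 alpha).
split=> [[_ mu0 la1]|/order2[mu0 la1]]; first exact/order2.
(* Admissibility comes for free: if every entry is divisible by [l], the sum of squares vanishes
   modulo [l]. *)
split=> // adm; move/order2: (conj mu0 la1).
rewrite f2 big1 ?oppr0 ?eqxx // => j _.
by rewrite zl_dvd_red ?expr0n.
Qed.


End Reduction.

(** * Haar measure of residue classes *)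

Section HaarResidues.
Variables (R : realType) (l t : nat) (l_prime : prime l).
Variables (tau : probability (borelZl l t) R) (tau_haar : haar tau).
Implicit Types c : 'rV['F_l]_t.

Definition residue_class c : set (borelZl l t) :=
  [set x : 'rV[Zl l]_t | map_mx (@zl_red l) x = c].

Lemma measurable_residue_class c : measurable (residue_class c).
Proof.
apply: sub_sigma_algebra; rewrite /= openE => x /= xc.
exists (fun i j => [set y | zl_res y 0 = zl_res (x i j) 0]) => [i j|y yx] /=.
  by exists 0%N.
rewrite -xc; apply/matrixP => i j; rewrite !mxE.
by apply/(zl_red_eq l_prime)/yx.
Qed.

(** Translation by an integral lift [a] of [c] carries the zero class onto the class of [c]. *)
Lemma haar_residue_class c : tau (residue_class c) = tau (residue_class 0).
Proof.
pose a : 'rV[Zl l]_t := \row_j (c 0 j : nat)%:R.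
have ac : map_mx (@zl_red l) a = c.
  by apply/rowP => j; rewrite !mxE zl_red_natr // natr_Zp.
rewrite -(tau_haar a (measurable_residue_class 0)); congr (tau _).
apply/seteqP; split => [x xc|_ [x x0 <-]]; rewrite /residue_class /=.
  exists (x - a); last by rewrite addrC subrK.
  apply/rowP => j; rewrite !mxE zl_redD // zl_redN //.
  move/rowP: xc => /(_ j); move/rowP: ac => /(_ j); rewrite !mxE => -> ->.
  by rewrite subrr.
apply/rowP => j; rewrite !mxE zl_redD //.
move/rowP: x0 => /(_ j); move/rowP: ac => /(_ j); rewrite !mxE => -> ->.
by rewrite addr0.
Qed.

Lemma haar_residues_mul (D : {pred 'rV['F_l]_t}) :
  tau [set x : 'rV[Zl l]_t | map_mx (@zl_red l) x \in D] =
  (#|D|%:R * fine (tau (residue_class 0)))%:E.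
Proof.
have -> : [set x : 'rV[Zl l]_t | map_mx (@zl_red l) x \in D] =
    \bigcup_(c in [set` enum D]) residue_class c.
  apply/seteqP; split=> [x xD|x [c /=]] /=.
    by exists (map_mx (@zl_red l) x); rewrite //= mem_enum.
  by rewrite mem_enum => cD ->.
rewrite measure_fin_bigcup; last 3 first.
- exact: finite_seq.
- by move=> c c' _ _ [x [/= <- <-]].
- by move=> c _; exact: measurable_residue_class.
rewrite -fsbig_seq ?enum_uniq //=.
rewrite (eq_bigr (fun=> (fine (tau (residue_class 0)))%:E)).
  by rewrite sumEFin big_const_seq count_predT -cardE iter_addr_0 mulr_natl.
move=> c _; rewrite haar_residue_class fineK // fin_num_measure //.
exact: measurable_residue_class.
Qed.

Lemma haar_residues (D : {pred 'rV['F_l]_t}) :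
  tau [set x : 'rV[Zl l]_t | map_mx (@zl_red l) x \in D] =
  (#|D|%:R / l%:R ^+ t)%:E.
Proof.
rewrite haar_residues_mul; congr (_ * _)%:E.
(* All [l ^ t] classes together have measure 1, which determines their common measure. *)
have := haar_residues_mul predT.
rewrite (_ : [set x | _] = setT) ?probability_setT; last by apply/seteqP.
rewrite card_mx card_Fp // mul1n natrX => -[tau0].
apply: (mulfI (x := l%:R ^+ t)); rewrite -?tau0 ?divff // expf_neq0 //;
  by rewrite pnatr_eq0 -lt0n prime_gt0.
Qed.

End HaarResidues.

(** * From point counts to the probability *)

Theorem theorem4p18 (R : realType) (l t : nat) (l_prime : prime l)
    (l_odd : odd l) (t_ge2 : (2 <= t)%N)
    (tau : probability (borelZl l t) R) (tau_haar : haar tau) :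
  Prob tau 0 1 =
  (if odd t then
     1 - ((l%:R : R) ^+ (t - 1) - 1) / (l%:R ^+ t - 1)
   else
     1 - ((l%:R : R) ^+ (t - 1)
          + (-1) ^+ ((t * (l - 1)) %/ 4) * (l%:R - 1) * l%:R ^+ (t %/ 2 - 1)
          - 1) / (l%:R ^+ t - 1))%:E.
Proof.
have F_card : #|'F_l| = l by rewrite card_Fp.
have F_odd : odd #|'F_l| by rewrite F_card.
have l_gt1 := prime_gt1 l_prime.
pose D := [pred c : 'rV['F_l]_t | \sum_j c 0 j ^+ 2 != 0].
(* This makes both [l ^ t] and [l ^ t - 1] nonzero, as clearing denominators requires. *)
have lt_gt1 : 1 < (l%:R : R) ^+ t by rewrite exprn_egt1 ?ltr1n // -lt0n ltnW.
have -> : Prob tau 0 1 =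
    (1 - (sphere_count R t (0 : 'F_l) - 1) / (l%:R ^+ t - 1))%:E.
  rewrite /Prob (_ : [set alpha | _] =
    [set x : 'rV[Zl l]_t | map_mx (@zl_red l) x \in D]); last first.
    have sumE (x : 'rV[Zl l]_t) : \sum_j map_mx (@zl_red l) x 0 j ^+ 2 =
        \sum_j zl_red (x 0 j) ^+ 2.
      by apply: eq_bigr => j _; rewrite mxE.
    apply/seteqP; split=> x /=; rewrite inE /= sumE;
      by move/(invariants_red l_prime l_odd).
  rewrite haar_residues //.
  have -> : #|D|%:R = l%:R ^+ t - sphere_count R t (0 : 'F_l).
    have := cardsC [set c : 'rV['F_l]_t | \sum_j c 0 j ^+ 2 == 0].
    rewrite card_mx mul1n F_card /sphere_count sum_indicator -natrX => <-.
    rewrite natrD addrAC subrr add0r; congr _%:R.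
    by apply: eq_card => c; rewrite !inE.
  rewrite -EFinM; congr _%:E; field.
  by rewrite subr_eq0 (gt_eqF lt_gt1) gt_eqF ?(lt_trans ltr01).
congr _%:E; case: ifP => t_odd.
  have {1}-> : t = t./2.*2.+1 by rewrite -[LHS]odd_double_half t_odd.
  rewrite sphere_count_odd // F_card; congr (1 - (_ ^+ _ - 1) / _).
  by rewrite -[t in RHS]odd_double_half t_odd addKn.
have [k tE] : exists k, t = k.+1.*2.
  by exists (t./2.-1); rewrite prednK ?half_gt0 // ?even_halfK ?t_odd.
have [h lE] : exists h, l.-1 = h.*2.
  by exists (l.-1./2); rewrite even_halfK // -subn1 oddB ?l_odd // ltnW.
rewrite tE sphere_count_even //= F_card lE doubleK.
(* Both [t] and [l - 1] are even, so the division by 4 is exact; [h] is half of [l - 1], the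
   exponent in [chi (-1) = (-1) ^+ h]. *)
have -> : (k.+1.*2 * (l - 1) %/ 4 = h * k.+1)%N.
  by rewrite subn1 lE -!muln2 mulnACA mulnK // mulnC.
by rewrite divn2 doubleK !subn1.
Qed.
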